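(* Consider the two-point boundary value problem $-u''=-6x$ in $(0,1)$, $u(0)=0$, $u(1)+u'(1)=0$, whose exact solution is $u(x)=x^3-2x$. For an integer $n\ge1$ let $h=\frac1n$, $x_i=ih$ ($0\le i\le n$), and let $V_h$ be the space of continuous functions on $[0,1]$ that are affine on each $[x_{i-1},x_i]$ and vanish at $0$. Let $u_h^\star\in V_h$ be the solution of the linear finite element method in which every element integral is replaced by the left-endpoint rectangle rule. Then there is a constant $C$ independent of $h$ such that $$\|u-u_h^\star\|_{L^2(0,1)}\ \ge\ \frac{\sqrt3}{3}\,h^{3/2}-C h^2 .$$ In particular, the optimal order $O(h^2)$ of the $L^2$-error is not attained with this quadrature rule.
   Context: The left-endpoint rectangle rule on $[x_{i-1},x_i]$ is $\int_{x_{i-1}}^{x_i}\varphi\,dx\approx (x_i-x_{i-1})\,\varphi(x_{i-1})$, where $\varphi(x_{i-1})$ means the value (one-sided limit) taken from inside $[x_{i-1},x_i]$; it has algebraic precision $0$. Thus $u_h^\star\in V_h$ is defined by $$\sum_{i=1}^n (x_i-x_{i-1})\,[(u_h^\star)'v_h'](x_{i-1}^+)+u_h^\star(1)v_h(1)=\sum_{i=1}^n (x_i-x_{i-1})\,(-6x_{i-1})\,v_h(x_{i-1})\qquad\forall v_h\in V_h .$$ *)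

(* Defs.v *)
(* Based on MathComp-Analysis. *)
From HB Require Import structures.
From mathcomp Require Import all_boot all_order all_algebra.
From mathcomp Require Import all_classical all_reals all_analysis.
Set Implicit Arguments.
Unset Strict Implicit.
Unset Printing Implicit Defensive.
Import Order.TTheory GRing.Theory Num.Theory.
Import numFieldNormedType.Exports.
Local Open Scope classical_set_scope.
Local Open Scope ring_scope.

(* Functions on [0, 1] are encoded as total functions R -> R; none of the
   definitions below depends on the values outside [0, 1]. *)

(* Classical solutions of - u'' = - 6 x in (0, 1), u(0) = 0, u(1) + u'(1) = 0,
   where u'(1) is the left derivative at the boundary point. *)
Definition bvp_solution (R : realType) (u : R -> R) : Prop :=
  [/\ {within `[0, 1], continuous u},
      forall x : R, 0 < x < 1 ->
        [/\ derivable u x 1, derivable (derive1 u) x 1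
          & - derive1 (derive1 u) x = - 6 * x],
      u 0 = 0
    & exists2 d : R,
        (u x - u 1) / (x - 1) @[x --> 1^'-] --> d & u 1 + d = 0].

Definition exact_u (R : realType) (x : R) : R := x ^+ 3 - 2 * x.

Definition mesh_size (R : realType) (n : nat) : R := n%:R^-1.

Definition node (R : realType) (n i : nat) : R := i%:R * mesh_size R n.

Definition fe_space (R : realType) (n : nat) : set (R -> R) :=
  [set v : R -> R | [/\ {within `[0, 1], continuous v},
      forall i : nat, (1 <= i <= n)%N ->
        exists a b : R, forall x : R,
          node R n i.-1 <= x <= node R n i -> v x = a * x + b
    & v 0 = 0]].

(* The integrand is only seen from inside [a, b]: its value at the left
   endpoint is the limit from the right at a, as it may jump there. *)
Definition left_rectangle (R : realType) (a b : R) (phi : R -> R) : R :=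
  (b - a) * lim (phi x @[x --> a^'+]).

(* The weak form \int_0^1 u' v' + u(1) v(1) = \int_0^1 (- 6 x) v with each
   element integral replaced by the left-endpoint rectangle rule. *)
Definition fem_solution (R : realType) (n : nat) (u : R -> R) : Prop :=
  fe_space n u /\
  forall v : R -> R, fe_space n v ->
    \sum_(1 <= i < n.+1)
      left_rectangle (node R n i.-1) (node R n i) (fun x => derive1 u x * derive1 v x)
    + u 1 * v 1
    = \sum_(1 <= i < n.+1)
      left_rectangle (node R n i.-1) (node R n i) (fun x => - 6 * x * v x).

Definition L2_norm01 (R : realType) (f : R -> R) : \bar R :=
  Lnorm (@lebesgue_measure R) 2%:E ((EFin \o f) \_ `]0, 1[).

(* Main.v *)
Require Import Defs.
From HB Require Import structures.
From mathcomp Require Import all_boot all_order all_algebra.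
From mathcomp Require Import all_classical all_reals all_analysis.
From mathcomp Require Import measurable_realfun ring lra.
Set Implicit Arguments.
Unset Strict Implicit.
Unset Printing Implicit Defensive.
Import Order.TTheory GRing.Theory Num.Theory.
Import numFieldNormedType.Exports.
Local Open Scope classical_set_scope.
Local Open Scope ring_scope.

(** The discrete problem can be solved in closed form.  Write [h = 1/n],
[alpha = 2 - 3h/2 + h^2/2] and [Q(x) = x^3 - alpha x].  Since the slopes of a
finite element function are constant on each element, the quadrature turns
the weak form into the difference scheme
[sum n (du)_i (dv)_i + u(1) v(1) = sum h (-6 x_i) v(x_i)], with [(du)_i] the
increment of [u] over the element starting at [x_i]
([fem_solutionE]).  The values [Q(x_i)] satisfy this scheme, by summation by
parts ([fem_nodal_value_summation]); taking the difference of two solutions as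
test function gives a vanishing sum of squares, so they are the only ones
([fem_solution_nodal_unique]).

Hence [u_h] is the piecewise affine interpolant of [Q].  As [x^3] is convex on
[[0, 1]], [u_h >= Q], and [Q(x) - u(x) = (2 - alpha) x = (3h/2 - h^2/2) x],
which is at least [h x] because [h <= 1].  The one-sided quadrature thus
leaves a pointwise error [u_h - u >= h x] ([fem_error_ge]), of first order
only.  Taking norms, the L2 error is at least [h |x|_2 = h sqrt 3 / 3]
([fem_L2_error_ge]), which dominates [h^(3/2) sqrt 3 / 3] and is not [O(h^2)].

For the differential equation itself, the difference of a solution and
[x^3 - 2x] has constant derivative [c] on the open interval, hence equals
[c x], and the boundary condition at 1 reads [2c = 0]
([bvp_solution_unique]). *)

(** * The boundary value problem *)

Lemma is_derive_exact_u (R : realType) (x : R) :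
  is_derive x 1 (@exact_u R) (3 * x ^+ 2 - 2).
Proof.
have -> : @exact_u R = id ^+ 3 - 2 *: id by apply/funext.
apply: is_derive_eq; rewrite /= !scaler1 -mulr_natl /GRing.scale /=; ring.
Qed.

Lemma derive1_exact_u (R : realType) :
  derive1 (@exact_u R) = fun x => 3 * x ^+ 2 - 2.
Proof.
apply/funext => x; rewrite derive1E.
by have [_ ->] := is_derive_exact_u x.
Qed.

Lemma is_derive2_exact_u (R : realType) (x : R) :
  is_derive x 1 (derive1 (@exact_u R)) (6 * x).
Proof.
have -> : derive1 (@exact_u R) = 3 *: id ^+ 2 - cst 2.
  by rewrite derive1_exact_u; apply/funext.
apply: is_derive_eq; rewrite /= !scaler1 -mulr_natl /GRing.scale /=; ring.
Qed.

Lemma continuous_exact_u (R : realType) : continuous (@exact_u R).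
Proof.
move=> x; apply/differentiable_continuous/derivable1_diffP.
by have [] := is_derive_exact_u x.
Qed.

(** The multiples of [x] are the kernel of the second derivative among the
functions vanishing at 0: this covers both the exact solution ([c = 0]) and
the candidates that uniqueness has to exclude. *)
Lemma left_derivative_at1 (R : realType) (w : R -> R) (c : R) :
  (forall x, 0 <= x <= 1 -> w x = exact_u x + c * x) ->
  (w x - w 1) / (x - 1) @[x --> 1^'-] --> 1 + c.
Proof.
move=> wE.
have : (x ^+ 2 + x - 1 + c : R) @[x --> (1 : R)^'-] --> (1 : R) ^+ 2 + 1 - 1 + c.
  apply: cvg_at_left_filter.
  apply: cvgD; last exact: cvg_cst.
  apply: cvgB; last exact: cvg_cst.
  apply: cvgD; last exact: cvg_id.
  exact: exprn_continuous.
have -> : (1 : R) ^+ 2 + 1 - 1 + c = 1 + c by ring.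
apply: cvg_trans; apply: near_eq_cvg.
have x0 : \forall x \near (1 : R)^'-, 0 < x by apply: nbhs_left_gt.
have x1 : \forall x \near (1 : R)^'-, x < 1 by apply: nbhs_left_lt.
near=> x.
have x_gt0 : 0 < x by near: x.
have x_lt1 : x < 1 by near: x.
rewrite !wE ?ler01 ?lexx ?(ltW x_gt0) ?(ltW x_lt1) //= /exact_u.
by field; rewrite subr_eq0 lt_eqF.
Unshelve. all: by end_near. Qed.

Lemma bvp_solution_exact_u (R : realType) : bvp_solution (@exact_u R).
Proof.
split.
- exact/continuous_subspaceT/continuous_exact_u.
- move=> x _; have [d1 _] := is_derive_exact_u x.
  have [d2 e2] := is_derive2_exact_u x.
  by split => //; rewrite derive1E e2 mulNr.
- by rewrite /exact_u expr0n mulr0 subr0.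
- exists 1; last by rewrite /exact_u; ring.
  have := @left_derivative_at1 R (@exact_u R) 0; rewrite addr0; apply.
  by move=> x _; rewrite mul0r addr0.
Qed.

(** The difference [g] of [w] and the exact solution has zero second derivative,
so two applications of the mean value theorem give [g x = c * x]; then [w 1]
is [-1 + c] and the left derivative at 1 is [1 + c], so [2 * c = 0]. *)
Lemma bvp_solution_unique (R : realType) (w : R -> R) :
  bvp_solution w -> {in `[0, 1], w =1 @exact_u R}.
Proof.
move=> [wc w2 w0 [d wd w1d]].
pose g := w - @exact_u R.
have gE x : g x = w x - exact_u x by [].
have gc : {within `[0, 1], continuous g}.
  by apply: within_continuousB => //; exact/continuous_subspaceT/continuous_exact_u.
pose dg := derive1 w - derive1 (@exact_u R).
have dgE (x : R) : 0 < x < 1 -> is_derive x 1 g (dg x).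
  move=> /w2[dw _ _]; rewrite /g.
  have iw : is_derive x 1 w (derive1 w x) by rewrite derive1E; exact: derivableP.
  apply: is_deriveB; rewrite derive1_exact_u; exact: is_derive_exact_u.
have dg0 (x : R) : 0 < x < 1 -> is_derive x 1 dg 0.
  move=> /w2[_ dw e].
  have iw : is_derive x 1 (derive1 w) (6 * x).
    have -> : 6 * x = derive1 (derive1 w) x by rewrite -[RHS]opprK e; ring.
    by rewrite derive1E; exact: derivableP.
  have := is_deriveB iw (is_derive2_exact_u x).
  by rewrite subrr.
(* The point 1/2 only serves to name the constant value of g' on ]0, 1[. *)
pose c := dg 2^-1.
have dgc_lt (x y : R) : 0 < x -> x < y -> y < 1 -> dg x = dg y.
  move=> x0 xy y1.
  have [| |_ _ /eqP] := @MVT R dg (fun=> 0) x y xy.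
  - move=> z; rewrite in_itv /= => /andP[xz zy]; apply: dg0.
    by rewrite (lt_trans x0 xz) (lt_trans zy y1).
  - apply: derivable_within_continuous => z; rewrite in_itv /= => /andP[xz zy].
    have z01 : 0 < z < 1 by rewrite (lt_le_trans x0 xz) (le_lt_trans zy y1).
    by have [] := dg0 z z01.
  - by rewrite mul0r subr_eq0 => /eqP.
have dgc (x : R) : 0 < x < 1 -> dg x = c.
  move=> /andP[x0 x1]; rewrite /c.
  have [h|h|->//] := ltgtP x 2^-1; last by rewrite -(dgc_lt _ _ _ h x1) //; lra.
  by apply: dgc_lt => //; lra.
have g0 : g 0 = 0 by rewrite gE w0 /exact_u; ring.
have wE (x : R) : 0 <= x <= 1 -> w x = exact_u x + c * x.
  move=> /andP[x0 x1].
  suff : g x = c * x by rewrite gE => <-; ring.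
  move: x0; rewrite le_eqVlt => /predU1P[<-|x0]; first by rewrite g0 mulr0.
  have [| |z zx] := @MVT R g (fun=> c) 0 x x0.
  - move=> z; rewrite in_itv /= => /andP[z0 zx].
    have z01 : 0 < z < 1 by rewrite z0 (lt_le_trans zx x1).
    by rewrite -(dgc z z01); exact: dgE.
  - apply: continuous_subspaceW gc => z /=.
    by rewrite !in_itv /= => /andP[-> zx]; exact: le_trans zx x1.
  - by rewrite g0 !subr0.
have dE : d = 1 + c.
  by apply: cvg_unique wd (left_derivative_at1 wE); exact: Rhausdorff.
have c0 : c = 0.
  by move: w1d; rewrite dE wE ?ler01 ?lexx // /exact_u => h; lra.
by move=> x; rewrite in_itv /= => /wE ->; rewrite c0 mul0r addr0.
Qed.

(** * The mesh *)

Lemma node0 (R : realType) n : node R n 0 = 0.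
Proof. by rewrite /node mul0r. Qed.

Lemma node_last (R : realType) n : (0 < n)%N -> node R n n = 1.
Proof. by move=> n0; rewrite /node /mesh_size divff // pnatr_eq0 -lt0n. Qed.

Lemma nodeS (R : realType) n i : node R n i.+1 = node R n i + mesh_size R n.
Proof. by rewrite /node -natr1 mulrDl mul1r. Qed.

Lemma mesh_size_gt0 (R : realType) n : (0 < n)%N -> 0 < mesh_size R n.
Proof. by move=> n0; rewrite invr_gt0 ltr0n. Qed.

Lemma mesh_size_le1 (R : realType) n : (0 < n)%N -> mesh_size R n <= 1.
Proof. by move=> n0; rewrite invf_le1 ?ltr0n // ler1n. Qed.

Lemma mesh_size_natr (R : realType) n :
  (0 < n)%N -> n%:R * mesh_size R n = 1.
Proof. by move=> n0; rewrite divff // pnatr_eq0 -lt0n. Qed.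

Lemma node_ge0 (R : realType) n i : 0 <= node R n i.
Proof. by rewrite mulr_ge0 // invr_ge0. Qed.

Lemma node_lt (R : realType) n i :
  (0 < n)%N -> node R n i < node R n i.+1.
Proof. by move=> n0; rewrite nodeS ltrDl mesh_size_gt0. Qed.

Lemma mem_element (R : realType) n (x : R) : (0 < n)%N -> 0 <= x <= 1 ->
  exists2 i, (i < n)%N & node R n i <= x <= node R n i.+1.
Proof.
move=> n0 /andP[x0]; rewrite -(node_last R n0).
suff: forall m, (0 < m)%N -> x <= node R n m ->
    exists2 i, (i < m)%N & node R n i <= x <= node R n i.+1 by apply.
elim=> // m IH _ xm.
have [xm'|xm'] := leP x (node R n m); last by exists m => //; rewrite ltW.
case: m IH xm xm' => [|m] IH xm xm'.
  by exists 0%N => //; rewrite xm node0 x0.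
by have [//|//|i im xi] := IH; exists i => //; exact: ltnW.
Qed.

(** * Finite element functions and the left-endpoint rule *)

Definition increment (R : realType) n (u : R -> R) (i : nat) : R :=
  u (node R n i.+1) - u (node R n i).

Lemma fe_affine (R : realType) n (u : R -> R) i (x : R) :
  fe_space n u -> (i < n)%N -> node R n i <= x <= node R n i.+1 ->
  u x = u (node R n i) + n%:R * increment n u i * (x - node R n i).
Proof.
move=> [_ uaff _] lt_in xi.
have n0 : (0 < n)%N by exact: leq_ltn_trans lt_in.
have [|a [b uE]] := uaff i.+1; first by [].
have le_ii : node R n i <= node R n i.+1 by rewrite ltW ?node_lt.
rewrite /increment !uE ?lexx ?le_ii //= nodeS.
have -> : a * (node R n i + mesh_size R n) + b - (a * node R n i + b)
  = a * mesh_size R n by ring.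
rewrite (mulrCA n%:R) mesh_size_natr //; ring.
Qed.

Lemma fe_derive1 (R : realType) n (u : R -> R) i (x : R) :
  fe_space n u -> (i < n)%N -> node R n i < x < node R n i.+1 ->
  derive1 u x = n%:R * increment n u i.
Proof.
move=> uV lt_in /andP[ix xi]; rewrite derive1E.
set s := n%:R * _.
pose l := cst (u (node R n i) - s * node R n i) + s *: (id : R -> R).
rewrite (@near_eq_derive _ _ _ _ l).
  have h : is_derive x 1 l s.
    by apply: is_derive_eq; rewrite add0r /GRing.scale /= mulr1.
  by have [_ ->] := h.
have : \forall y \near x, y \in `]node R n i, node R n i.+1[.
  by apply: near_in_itvoo; rewrite in_itv /= ix.
apply: filterS => y; rewrite in_itv /= => /andP[h1 h2].
have -> : l y = u (node R n i) - s * node R n i + s * y by [].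
by rewrite (@fe_affine _ n u i y) ?ltW // /s; ring.
Qed.

(** The rule only sees the integrand inside the element, where it may be
replaced by a function [psi] that is continuous at the left node. *)
Lemma left_rectangle_lim (R : realType) (a b l : R) (phi psi : R -> R) :
  a < b -> (forall x, a < x < b -> phi x = psi x) ->
  psi x @[x --> a] --> l -> left_rectangle a b phi = (b - a) * l.
Proof.
move=> ab phiE /cvg_at_right_filter psil; congr (_ * _).
apply: cvg_lim; first exact: Rhausdorff.
apply: cvg_trans psil; apply: near_eq_cvg.
have ax : \forall x \near a^'+, a < x by exact: nbhs_right_gt.
have xb : \forall x \near a^'+, x < b by exact: nbhs_right_lt.
near=> x; apply/esym/phiE/andP; split; by near: x.
Unshelve. all: by end_near. Qed.

(** Both slopes are [n] times an increment, and one of the two factors [n]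
cancels the length of the element. *)
Lemma left_rectangle_stiffness (R : realType) n (u v : R -> R) i :
  fe_space n u -> fe_space n v -> (i < n)%N ->
  left_rectangle (node R n i) (node R n i.+1)
    (fun x => derive1 u x * derive1 v x)
  = n%:R * (increment n u i * increment n v i).
Proof.
move=> uV vV lt_in; have n0 : (0 < n)%N by exact: leq_ltn_trans lt_in.
pose s := n%:R * increment n u i * (n%:R * increment n v i).
rewrite (@left_rectangle_lim _ _ _ s _ (fun=> s)) ?node_lt //.
- rewrite nodeS addrC addKr.
  have -> : mesh_size R n * s
    = n%:R * mesh_size R n * (n%:R * (increment n u i * increment n v i)).
    by rewrite /s; ring.
  by rewrite mesh_size_natr // mul1r.
- by move=> x xi; rewrite (@fe_derive1 _ n u i) // (@fe_derive1 _ n v i).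
- exact: cvg_cst.
Qed.

Lemma left_rectangle_load (R : realType) n (v : R -> R) i :
  fe_space n v -> (i < n)%N ->
  left_rectangle (node R n i) (node R n i.+1) (fun x => - 6 * x * v x)
  = mesh_size R n * (- 6 * node R n i * v (node R n i)).
Proof.
move=> vV lt_in; have n0 : (0 < n)%N by exact: leq_ltn_trans lt_in.
set xi := node R n i; pose s := n%:R * increment n v i.
pose vi x := v xi + s * (x - xi).
rewrite (@left_rectangle_lim _ _ _ (- 6 * xi * vi xi) _
  (fun x => - 6 * x * vi x)) ?node_lt //.
- by rewrite nodeS [_ + mesh_size _ _ - _]addrC addKr /vi subrr mulr0 addr0.
- move=> x /andP[h1 h2]; congr (_ * _).
  by rewrite (@fe_affine _ n v i x) // !ltW.
- apply: cvgM; first by apply: cvgM; [exact: cvg_cst|exact: cvg_id].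
  apply: cvgD; first exact: cvg_cst.
  apply: cvgM; first exact: cvg_cst.
  by apply: cvgB; [exact: cvg_id|exact: cvg_cst].
Qed.

(** With the quadrature the discrete problem involves nodal values only. *)
Lemma fem_solutionE (R : realType) n (u : R -> R) : (0 < n)%N ->
  fem_solution n u <->
  fe_space n u /\ forall v : R -> R, fe_space n v ->
    \sum_(i < n) n%:R * (increment n u i * increment n v i) + u 1 * v 1
    = \sum_(i < n) mesh_size R n * (- 6 * node R n i * v (node R n i)).
Proof.
move=> n0; have stiffnessE v : fe_space n u -> fe_space n v ->
    \sum_(1 <= i < n.+1) left_rectangle (node R n i.-1) (node R n i)
      (fun x => derive1 u x * derive1 v x)
    = \sum_(i < n) n%:R * (increment n u i * increment n v i).
  move=> uV vV; rewrite big_add1 /= big_mkord; apply: eq_bigr => i _.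
  exact: left_rectangle_stiffness.
have loadE v : fe_space n v ->
    \sum_(1 <= i < n.+1) left_rectangle (node R n i.-1) (node R n i)
      (fun x => - 6 * x * v x)
    = \sum_(i < n) mesh_size R n * (- 6 * node R n i * v (node R n i)).
  move=> vV; rewrite big_add1 /= big_mkord; apply: eq_bigr => i _.
  exact: left_rectangle_load.
by split=> -[uV uE]; split=> // v vV; have := uE v vV; rewrite stiffnessE // loadE.
Qed.

(** * Interpolation by finite element functions *)

Lemma fe_space_linear (R : realType) n (a : R) (u v : R -> R) :
  fe_space n u -> fe_space n v -> fe_space n (fun x => a * u x + v x).
Proof.
move=> [uc ua u0] [vc va v0]; split.
- apply: within_continuousD => // x.
  by apply: cvgM; [exact: cvg_cst|exact: uc].
- move=> i lt_in; have [b [c uE]] := ua i lt_in; have [d [e vE]] := va i lt_in.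
  by exists (a * b + d), (a * c + e) => x xi; rewrite uE // vE //; ring.
- by rewrite u0 v0 mulr0 addr0.
Qed.

Lemma fe_space0 (R : realType) n : fe_space n (fun=> 0 : R).
Proof.
split=> //; first by move=> x; exact: cvg_cst.
by move=> i _; exists 0, 0 => x _; rewrite mul0r addr0.
Qed.

Lemma fe_space_sum (R : realType) n m (a : nat -> R) (u : nat -> R -> R) :
  (forall k, fe_space n (u k)) ->
  fe_space n (fun x => \sum_(k < m) a k * u k x).
Proof.
move=> uV; elim: m => [|m IH].
  by under eq_fun do rewrite big_ord0; exact: fe_space0.
under eq_fun do rewrite big_ord_recr /= addrC.
exact: fe_space_linear.
Qed.

(** The ramp rising from 0 to 1 across the element between the nodes [k] and
[k.+1]: the primitive of a normalised indicator, so that prescribed increments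
can be realised by a sum of ramps. *)
Definition ramp (R : realType) (n k : nat) (x : R) : R :=
  Num.max 0 (Num.min 1 (n%:R * x - k%:R)).

Lemma ramp_le0 (R : realType) n k (x : R) : n%:R * x <= k%:R -> ramp n k x = 0.
Proof.
move=> xk; apply/max_idPl; rewrite ge_min subr_le0 xk orbT //.
Qed.

Lemma ramp_ge1 (R : realType) n k (x : R) :
  k.+1%:R <= n%:R * x -> ramp n k x = 1.
Proof.
rewrite -natr1 addrC -lerBrDr => xk.
by rewrite /ramp (min_idPl xk); apply/max_idPr.
Qed.

Lemma natr_node (R : realType) n i : (0 < n)%N -> n%:R * node R n i = i%:R.
Proof. by move=> n0; rewrite mulrCA mesh_size_natr // mulr1. Qed.

Lemma ramp_node (R : realType) n k i :
  (0 < n)%N -> ramp n k (node R n i) = (k < i)%:R.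
Proof.
move=> n0; have [ki|ik] := ltnP k i.
  by rewrite ramp_ge1 // natr_node // ler_nat.
by rewrite ramp_le0 // natr_node // ler_nat.
Qed.

Lemma fe_space_ramp (R : realType) n k : fe_space n (@ramp R n k).
Proof.
split.
- apply: continuous_subspaceT => x.
  apply: (@continuous_max R R (cst 0)
    (fun y => Num.min 1 (n%:R * y - k%:R))); first exact: cvg_cst.
  apply: (@continuous_min R R (cst 1)
    (fun y => n%:R * y - k%:R)); first exact: cvg_cst.
  apply: cvgB; last exact: cvg_cst.
  by apply: cvgM; [exact: cvg_cst|exact: cvg_id].
- move=> [//|i] /andP[_ lt_in] /=.
  have n0 : (0 < n)%N by exact: leq_ltn_trans lt_in.
  have scale (x : R) : node R n i <= x <= node R n i.+1 ->
      i%:R <= n%:R * x <= i.+1%:R.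
    by rewrite -(natr_node R i n0) -(natr_node R i.+1 n0) !ler_pM2l ?ltr0n.
  have [ki|ik|ki] := ltngtP k i.
  + exists 0, 1 => x /scale/andP[h _]; rewrite mul0r add0r ramp_ge1 //.
    by apply: le_trans h; rewrite ler_nat.
  + exists 0, 0 => x /scale/andP[_ h]; rewrite mul0r add0r ramp_le0 //.
    by apply: (le_trans h); rewrite ler_nat.
  + exists n%:R, (- k%:R) => x /scale; rewrite -ki -natr1 => /andP[h1 h2].
    rewrite /ramp (min_idPr _); last by rewrite lerBlDl.
    by apply/max_idPr; rewrite subr_ge0.
- by rewrite ramp_le0 // mulr0.
Qed.

(** The combination of the ramps weighted by the increments of [U] telescopes
at each node. *)
Lemma fe_interpolation (R : realType) n (U : nat -> R) : (0 < n)%N -> U 0 = 0 ->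
  exists2 u : R -> R, fe_space n u &
    forall i, (i <= n)%N -> u (node R n i) = U i.
Proof.
move=> n0 U0.
exists (fun x => \sum_(k < n) (U k.+1 - U k) * ramp n k x).
  by apply: (fe_space_sum n (fun k => U k.+1 - U k)) => k; exact: fe_space_ramp.
move=> i le_in.
transitivity (\sum_(k < i) (U k.+1 - U k)).
  rewrite (big_ord_widen _ (fun k => U k.+1 - U k) le_in) [RHS]big_mkcond /=.
  apply: eq_bigr => k _; rewrite ramp_node //.
  by case: ifP => _; rewrite ?mulr1 ?mulr0.
by rewrite -(big_mkord xpredT (fun k => U k.+1 - U k)) telescope_sumr // U0 subr0.
Qed.

(** * The discrete solution *)

Definition fem_slope (R : realType) (n : nat) : R :=
  2 - 3 / 2 * mesh_size R n + mesh_size R n ^+ 2 / 2.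

(** The closed form of the discrete solution at the nodes: solving
[s_(j+1) = s_j + 6 h x_j] for the slopes [s_j] gives
[x_j^3 - h^2 x_j + s_1 x_j], and the boundary equation [s_n + u(1) = 0] fixes
the coefficient of [x_j]. *)
Definition fem_nodal_value (R : realType) (n i : nat) : R :=
  node R n i ^+ 3 - fem_slope R n * node R n i.

(** Summation by parts: the factor of [V m] is the slope of the discrete
solution on the element ending at node [m], and consecutive slopes differ by
[6 h x_m], which is the load. *)
Lemma fem_nodal_value_summation (R : realType) n m (V : nat -> R) :
  (0 < n)%N -> V 0 = 0 ->
  \sum_(i < m) n%:R * ((fem_nodal_value R n i.+1 - fem_nodal_value R n i)
                       * (V i.+1 - V i))
  = \sum_(i < m) mesh_size R n * (- 6 * node R n i * V i)
    + (3 * node R n m ^+ 2 - 3 * node R n m * mesh_size R n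
       + mesh_size R n ^+ 2 - fem_slope R n) * V m.
Proof.
move=> n0 V0; elim: m => [|m IH]; first by rewrite !big_ord0 V0 mulr0 addr0.
rewrite !big_ord_recr /= {}IH mulrA.
have -> : n%:R * (fem_nodal_value R n m.+1 - fem_nodal_value R n m)
    = n%:R * mesh_size R n * (3 * node R n m ^+ 2
       + 3 * node R n m * mesh_size R n + mesh_size R n ^+ 2 - fem_slope R n).
  by rewrite /fem_nodal_value nodeS; ring.
by rewrite mesh_size_natr // nodeS; ring.
Qed.

Lemma fem_solution_exists (R : realType) n : (0 < n)%N ->
  exists2 u : R -> R, fem_solution n u &
    forall i, (i <= n)%N -> u (node R n i) = fem_nodal_value R n i.
Proof.
move=> n0; have [|u uV uE] := @fe_interpolation R n (fem_nodal_value R n) n0.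
  by rewrite /fem_nodal_value node0; ring.
exists u => //; apply/fem_solutionE => //; split=> // v vV.
under eq_bigr => i _.
  rewrite /increment !uE ?(ltnW (ltn_ord i)) //; over.
rewrite (@fem_nodal_value_summation R n n (fun i => v (node R n i))) //; last first.
  by rewrite node0; case: vV.
(* The boundary terms cancel: this is the equation that determines fem_slope. *)
rewrite -addrA -(node_last R n0) uE // -mulrDl /fem_nodal_value node_last //.
rewrite /fem_slope [X in X * v 1](_ : _ = 0) ?mul0r ?addr0 //; by field.
Qed.

(** Coercivity: tested with the difference [e] of the two solutions, the scheme
gives [sum n (de)_i^2 + e(1)^2 = 0], so [e] has no increments. *)
Lemma fem_solution_nodal_unique (R : realType) n (u w : R -> R) : (0 < n)%N ->
  fem_solution n u -> fem_solution n w ->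
  forall i, (i <= n)%N -> w (node R n i) = u (node R n i).
Proof.
move=> n0 /(fem_solutionE _ n0)[uV uE] /(fem_solutionE _ n0)[wV wE].
pose e x := - 1 * u x + w x.
have eV : fe_space n e by exact: fe_space_linear.
have incE i : increment n e i = increment n w i - increment n u i.
  by rewrite /increment /e; ring.
have energy : \sum_(i < n) n%:R * (increment n e i) ^+ 2 + e 1 ^+ 2 = 0.
  transitivity (\sum_(i < n) n%:R * (increment n w i * increment n e i) + w 1 * e 1
    - (\sum_(i < n) n%:R * (increment n u i * increment n e i) + u 1 * e 1)).
    rewrite opprD addrACA -sumrB -mulrBl; congr (_ + _).
      by apply: eq_bigr => i _; rewrite incE; ring.
    by rewrite /e; ring.
  by rewrite uE // wE // subrr.
have inc0 (i : 'I_n) : increment n e i = 0.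
  have : \sum_(i < n) n%:R * (increment n e i) ^+ 2 = 0.
    apply/eqP; rewrite eq_le; apply/andP; split.
      by rewrite -[leRHS]energy lerDl sqr_ge0.
    by apply: sumr_ge0 => j _; rewrite mulr_ge0 ?sqr_ge0.
  move=> /eqP; rewrite psumr_eq0 => [|j _]; last by rewrite mulr_ge0 ?sqr_ge0.
  move=> /allP/(_ i (mem_index_enum i)) /=.
  by rewrite mulf_eq0 pnatr_eq0 -[_ == _]negbK -lt0n n0 /= sqrf_eq0 => /eqP.
suff e0 i : (i <= n)%N -> e (node R n i) = 0.
  by move=> i /e0 /eqP; rewrite /e mulN1r addrC subr_eq0 => /eqP.
elim: i => [|i IH] lt_in; first by rewrite node0; case: eV.
by have /eqP := inc0 (Ordinal lt_in); rewrite subr_eq0 IH ?(ltnW lt_in) // => /eqP.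
Qed.

Lemma fem_solution_nodal (R : realType) n (u : R -> R) i : (0 < n)%N ->
  fem_solution n u -> (i <= n)%N -> u (node R n i) = fem_nodal_value R n i.
Proof.
move=> n0 uS le_in; have [w wS <- //] := fem_solution_exists R n0.
exact: fem_solution_nodal_unique.
Qed.

Lemma fem_solution_unique (R : realType) n (u w : R -> R) : (0 < n)%N ->
  fem_solution n u -> fem_solution n w -> {in `[0, 1], w =1 u}.
Proof.
move=> n0 uS wS x; rewrite in_itv /= => /(mem_element n0)[i lt_in xi].
rewrite (fe_affine (proj1 uS) lt_in xi) (fe_affine (proj1 wS) lt_in xi).
by rewrite /increment !(fem_solution_nodal_unique n0 uS wS) // ltnW.
Qed.

(** On an element [[a, b]], the interpolant of [x^3] exceeds [x^3] by
[(x - a)(b - x)(a + b + x) >= 0], and the linear term contributes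
[(2 - fem_slope R n) x = h x + h (1 - h) / 2 x]. *)
Lemma fem_error_ge (R : realType) n (u : R -> R) (x : R) : (0 < n)%N ->
  fem_solution n u -> 0 <= x <= 1 -> mesh_size R n * x <= u x - exact_u x.
Proof.
move=> n0 uS x01; have [i lt_in xi] := mem_element n0 x01.
rewrite (fe_affine (proj1 uS) lt_in xi) /increment.
rewrite !(fem_solution_nodal n0 uS) // ?(ltnW lt_in) //.
set a := node R n i; set h := mesh_size R n; set b := node R n i.+1.
have bE : b = a + h by exact: nodeS.
have -> : n%:R * (fem_nodal_value R n i.+1 - fem_nodal_value R n i)
    = n%:R * h * (a ^+ 2 + a * b + b ^+ 2 - fem_slope R n).
  by rewrite /fem_nodal_value -/a -/b bE; ring.
rewrite mesh_size_natr // mul1r /fem_nodal_value -/a.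
have [ax xb] : a <= x /\ x <= b by exact/andP.
have [x0 x1] := andP x01.
have convex : 0 <= (x - a) * (b - x) * (a + b + x).
  have a0 : 0 <= a := node_ge0 R n i.
  by rewrite !mulr_ge0 ?subr_ge0 //; lra.
rewrite -subr_ge0 /exact_u.
have -> : a ^+ 3 - fem_slope R n * a
    + (a ^+ 2 + a * b + b ^+ 2 - fem_slope R n) * (x - a)
    - (x ^+ 3 - 2 * x) - h * x
  = (x - a) * (b - x) * (a + b + x) + h * (1 - h) / 2 * x.
  by rewrite /fem_slope -/h; field.
rewrite addr_ge0 // !mulr_ge0 ?invr_ge0 // ?subr_ge0 ?mesh_size_le1 //.
Qed.

(** * The L2 norm of the error *)

Lemma continuous_scale_sqr (R : realType) (c : R) :
  continuous (fun x : R => (c * x) ^+ 2).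
Proof.
move=> x; apply: (@continuous_comp _ _ _ ( *%R c) (fun y => y ^+ 2)).
  by apply: cvgM; [exact: cvg_cst|exact: cvg_id].
exact: exprn_continuous.
Qed.

Lemma integral_sqr01 (R : realType) (c : R) :
  (\int[lebesgue_measure]_(x in `]0%R, 1%R[) ((c * x) ^+ 2)%:E
   = (c ^+ 2 / 3)%:E)%E.
Proof.
have qc : continuous (fun x => (c * x) ^+ 2) by exact: continuous_scale_sqr.
rewrite -(@integral_itv_bndoo R 0 1 _ true false); last first.
  apply/measurable_EFinP; apply: measurable_funTS.
  exact: continuous_measurable_fun.
pose F := c ^+ 2 / 3 *: (id : R -> R) ^+ 3.
have dF (x : R) : is_derive x 1 F ((c * x) ^+ 2).
  by apply: is_derive_eq; rewrite /= scaler1 -mulr_natl /GRing.scale /=; field.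
have Fc : continuous F.
  move=> x; apply/differentiable_continuous/derivable1_diffP.
  by have [] := dF x.
rewrite (@continuous_FTC2 R _ F 0 1) //.
- rewrite -EFinB; congr _%:E.
  have FE y : F y = c ^+ 2 / 3 * y ^+ 3 by [].
  by rewrite !FE; ring.
- exact: continuous_subspaceT.
- split; first by move=> x _; have [] := dF x.
  + exact/cvg_at_right_filter/Fc.
  + exact/cvg_at_left_filter/Fc.
- by move=> x _; rewrite derive1E; have [_ ->] := dF x.
Qed.

Lemma L2_norm01_ge_linear (R : realType) (f : R -> R) (c : R) : 0 <= c ->
  measurable_fun (`]0, 1[%classic : set R) f ->
  (forall x, 0 < x < 1 -> c * x <= `|f x|) ->
  ((Num.sqrt 3 / 3 * c)%:E <= L2_norm01 f)%E.
Proof.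
move=> c0 mf fge; rewrite /L2_norm01 unlock.
rewrite [X in poweR X _](_ : _ =
  (\int[lebesgue_measure]_(x in `]0%R, 1%R[) ((f x) ^+ 2)%:E)%E); last first.
  rewrite [RHS]integral_mkcond; apply: eq_integral => x _.
  rewrite /patch; case: ifPn => _ /=.
    by rewrite powR_mulrn // real_normK ?num_real.
  by rewrite normr0 powR0 // pnatr_eq0.
have -> : (Num.sqrt 3 / 3 * c)%:E = ((c ^+ 2 / 3)%:E `^ 2^-1)%E :> \bar R.
  rewrite poweR_EFin powR12_sqrt; last by rewrite mulr_ge0 ?sqr_ge0 ?invr_ge0.
  rewrite sqrtrM ?sqr_ge0 // sqrtr_sqr ger0_norm // sqrtrV // mulrC.
  congr (_ * _)%:E; have s3 : Num.sqrt 3 != 0 :> R by rewrite sqrtr_eq0 -ltNge.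
  rewrite -[X in _ / X = _](sqr_sqrtr (ler0n R 3)); by field.
apply: gt0_ler_poweR; rewrite ?invr_ge0 //.
- by rewrite in_itv /= lee_fin mulr_ge0 ?sqr_ge0 ?invr_ge0 //= leey.
- rewrite in_itv /= leey andbT; apply: integral_ge0 => x _.
  by rewrite lee_fin sqr_ge0.
rewrite -integral_sqr01; apply: ge0_le_integral => //.
- by move=> x _; rewrite lee_fin sqr_ge0.
- apply/measurable_EFinP; apply: measurable_funTS.
  apply: continuous_measurable_fun; exact: continuous_scale_sqr.
- apply/measurable_EFinP; apply: measurable_funX.
  exact: mf.
- move=> x; rewrite /= in_itv /= => x01; rewrite lee_fin.
  rewrite -[(f x) ^+ 2]real_normK ?num_real // lerXn2r ?nnegrE ?fge //.
  by case/andP: x01 => x0 _; rewrite mulr_ge0 // ltW.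
Qed.

Lemma fem_L2_error_ge (R : realType) n (u : R -> R) : (0 < n)%N ->
  fem_solution n u ->
  ((Num.sqrt 3 / 3 * mesh_size R n)%:E
     <= L2_norm01 (fun x => exact_u x - u x)%R)%E.
Proof.
move=> n0 uS; apply: L2_norm01_ge_linear.
- exact/ltW/mesh_size_gt0.
- apply: measurable_funB.
    apply: measurable_funTS; apply: continuous_measurable_fun.
    exact: continuous_exact_u.
  apply: (@measurable_funS _ _ _ _ (`[0, 1]%classic : set R)) => //.
    exact: subset_itv_oo_cc.
  apply: subspace_continuous_measurable_fun => //.
  by have [[]] := uS.
- move=> x /andP[x0 x1]; rewrite distrC; apply: le_trans (ler_norm _).
  by apply: fem_error_ge => //; rewrite !ltW.
Qed.

Lemma mesh_size_powR_le (R : realType) n : (0 < n)%N ->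
  mesh_size R n `^ (3 / 2) <= mesh_size R n.
Proof.
move=> n0; apply: ge1r_powR; last by lra.
by rewrite mesh_size_gt0 ?mesh_size_le1.
Qed.

(** An upper bound [C h^2] would force [n sqrt 3 / 3 <= C]. *)
Lemma fem_L2_error_not_OX2 (R : realType) : ~ (exists C : R,
  \forall n \near \oo, forall u : R -> R, fem_solution n u ->
    (L2_norm01 (fun x => exact_u x - u x)%R
       <= (C * mesh_size R n ^+ 2)%:E)%E).
Proof.
move=> [C [N _ errle]].
pose n := maxn N (Num.truncn (3 * C)).+1.
have n0 : (0 < n)%N by rewrite leq_max orbT.
have Cn : 3 * C < n%:R.
  by apply: lt_le_trans (truncnS_gt _) _; rewrite ler_nat leq_maxr.
have [u uS _] := fem_solution_exists R n0.
have := le_trans (fem_L2_error_ge n0 uS) (errle n (leq_maxl _ _) u uS).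
rewrite lee_fin expr2 mulrA ler_pM2r ?mesh_size_gt0 //.
rewrite -(ler_pM2r (_ : 0 < n%:R)) ?ltr0n // -[leRHS]mulrA.
rewrite [_ * n%:R in leRHS]mulrC mesh_size_natr // mulr1 => Cge.
have s3 : 1 <= Num.sqrt 3 :> R by rewrite -[leLHS]sqrtr1 ler_sqrt // ler1n.
have : n%:R <= Num.sqrt 3 * n%:R :> R by rewrite ler_peMl.
by lra.
Qed.

Theorem mainTheorem3 (R : realType) :
  (* the exact solution of the boundary value problem *)
  (bvp_solution (@exact_u R) /\
   forall w : R -> R, bvp_solution w -> {in `[0, 1], w =1 @exact_u R}) /\
  (* the discrete problem determines u_h on [0, 1] *)
  (forall n : nat, (1 <= n)%N ->
     exists2 uh : R -> R, fem_solution n uh &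
       forall w : R -> R, fem_solution n w -> {in `[0, 1], w =1 uh}) /\
  (* the lower bound *)
  (exists C : R, forall (n : nat) (uh : R -> R), (1 <= n)%N ->
     fem_solution n uh ->
     ((Num.sqrt 3 / 3 * mesh_size R n `^ (3 / 2) - C * mesh_size R n ^+ 2)%:E
        <= L2_norm01 (fun x => exact_u x - uh x)%R)%E) /\
  (* the error is not O(h^2) as h tends to 0 *)
  ~ (exists C : R, \forall n \near \oo, forall uh : R -> R,
       fem_solution n uh ->
       (L2_norm01 (fun x => exact_u x - uh x)%R
          <= (C * mesh_size R n ^+ 2)%:E)%E).
Proof.
split; first by split; [exact: bvp_solution_exact_u|exact: bvp_solution_unique].
split.
  move=> n n0; have [u uS _] := fem_solution_exists R n0.
  by exists u => // w; exact: fem_solution_unique.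
split; last exact: fem_L2_error_not_OX2.
(* As h <= 1, h^(3/2) <= h, so the first-order bound suffices with C = 0. *)
exists 0 => n u n0 uS; apply: le_trans (fem_L2_error_ge n0 uS).
rewrite mul0r subr0 lee_fin ler_wpM2l ?mesh_size_powR_le //.
Qed.
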